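(* Let $\Lambda=\mathbf{k}Q$ be a tame hereditary algebra over an algebraically closed field $\mathbf{k}$, where $Q$ is a tame quiver, and let $\mathcal{A}=\mathrm{mod}\text{-}\Lambda$ be the category of finitely generated $\Lambda$-modules. Then every stability data on $\mathcal{A}$ can be refined to a finest one; that is, for every stability data on $\mathcal{A}$ there exists a finest stability data on $\mathcal{A}$ that is finer than it.
   Context: A tame quiver is a connected acyclic quiver whose underlying graph is of Euclidean (extended Dynkin) type. All subcategories are full and closed under isomorphisms. $\langle\mathcal{S}\rangle$ denotes the smallest subcategory of $\mathcal{A}$ containing $\mathcal{S}$ and closed under extensions and direct summands. A stability data on an abelian category $\mathcal{A}$ is a pair $(\Phi,\{\Pi_\varphi\}_{\varphi\in\Phi})$ where $\Phi$ is a linearly ordered set and each $\Pi_\varphi\subset\mathcal{A}$ is a non-zero extension-closed subcategory, such that: (1) $\mathrm{Hom}(\Pi_{\varphi'},\Pi_{\varphi''})=0$ for all $\varphi'>\varphi''$ in $\Phi$; (2) every non-zero $X\in\mathcal{A}$ has a finite filtration $0=X_0\subset X_1\subset\cdots\subset X_n=X$ with non-zero factors $X_i/X_{i-1}\in\Pi_{\varphi_i}$ and $\varphi_1>\cdots>\varphi_n$. Two stability data $(\Phi,\{\Pi_\varphi\})$, $(\Psi,\{P_\psi\})$ are equivalent if there is an order-preserving bijection $r:\Phi\to\Psi$ with $P_{r(\varphi)}=\Pi_\varphi$ for all $\varphi$. $(\Psi,\{P_\psi\})$ is finer than $(\Phi,\{\Pi_\varphi\})$ if there is a surjective map $r:\Psi\to\Phi$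 such that $\psi'>\psi''$ implies $r(\psi')\geq r(\psi'')$, and $\Pi_\varphi=\langle P_\psi\mid\psi\in r^{-1}(\varphi)\rangle$ for every $\varphi\in\Phi$. A stability data is finest if every stability data finer than it is equivalent to it. *)

(* Defs.v *)
From HB Require Import structures.
From mathcomp Require Import all_boot all_order all_algebra.
From mathcomp Require Import finmap.
From mathcomp.multinomials Require Import monalg.

Set Implicit Arguments.
Unset Strict Implicit.
Unset Printing Implicit Defensive.

Import Order.TTheory GRing.Theory.
Local Open Scope ring_scope.

Record quiver := Quiver {
  vertex : finType;
  arrow : finType;
  src : arrow -> vertex;
  tgt : arrow -> vertex }.

(** A path is written from left to right: it is a starting vertex [x] together
    with a sequence of arrows [a1, ..., an] with [src a1 = x] and
    [tgt ai = src a(i+1)]; the path of length 0 at [x] is [(x, [::])]. *)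
Fixpoint walk (Q : quiver) (x : vertex Q) (s : seq (arrow Q)) : bool :=
  if s is a :: s' then (src a == x) && walk (tgt a) s' else true.

Record qpath (Q : quiver) := QPath {
  qpval :> vertex Q * seq (arrow Q);
  qpvalP : walk qpval.1 qpval.2 }.

HB.instance Definition _ Q := [isSub for @qpval Q].
HB.instance Definition _ Q := [Choice of qpath Q by <:].

Definition psrc Q (p : qpath Q) : vertex Q := p.1.
Definition ptgt Q (p : qpath Q) : vertex Q := last p.1 [seq tgt a | a <- p.2].
Definition plen Q (p : qpath Q) : nat := size p.2.

Definition path0 Q (x : vertex Q) : qpath Q := @QPath Q (x, [::]) isT.

Lemma walk_cat Q (x : vertex Q) s1 s2 :
  walk x (s1 ++ s2) = walk x s1 && walk (last x [seq tgt a | a <- s1]) s2.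
Proof. by elim: s1 x => //= a s IHs x; rewrite IHs andbA. Qed.

Lemma pcat_subproof Q (p q : qpath Q) :
  ptgt p = psrc q -> walk p.1 (p.2 ++ q.2).
Proof. by move=> e; rewrite walk_cat (qpvalP p) -/(ptgt p) e (qpvalP q). Qed.

(** Concatenation "[p], then [q]", defined when [p] ends where [q] starts. *)
Definition pcat Q (p q : qpath Q) : option (qpath Q) :=
  if ptgt p =P psrc q is ReflectT e then
    Some (@QPath Q (p.1, p.2 ++ q.2) (pcat_subproof e))
  else None.

Definition qadj (Q : quiver) : rel (vertex Q) := fun x y =>
  [exists a : arrow Q, ((src a == x) && (tgt a == y)) ||
                       ((src a == y) && (tgt a == x))].

Definition qconnected (Q : quiver) : Prop :=
  (0 < #|vertex Q|)%N /\ forall x y : vertex Q, connect (@qadj Q) x y.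

Definition qacyclic (Q : quiver) : Prop :=
  forall p : qpath Q, (0 < plen p)%N -> psrc p != ptgt p.

(** A multigraph on the vertices [0, ..., n-1] is given by its list of edges
    (unordered pairs, possibly repeated). *)
Definition nb_edges (E : seq (nat * nat)) (x y : nat) : nat :=
  count (fun e => (e == (x, y)) || (e == (y, x))) E.

Definition nb_arrows (Q : quiver) (x y : vertex Q) : nat :=
  #|[set a : arrow Q | ((src a, tgt a) == (x, y)) ||
                       ((src a, tgt a) == (y, x))]|.

Definition underlying_graph_is (Q : quiver) (n : nat) (E : seq (nat * nat)) :
    Prop :=
  exists2 f : vertex Q -> 'I_n, bijective f &
    forall x y : vertex Q, nb_arrows x y = nb_edges E (f x) (f y).

(** Ã_n is the cycle with n+1 vertices (a double edge for n = 1); D̃_n has n+1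
    vertices, the path 2 - ... - (n-2) with two more leaves at either end. *)
Definition Atilde (n : nat) : seq (nat * nat) :=
  [seq (i, i.+1 %% n.+1)%N | i <- iota 0 n.+1].

Definition Dtilde (n : nat) : seq (nat * nat) :=
  [:: (0, 2); (1, 2); (n - 2, n - 1); (n - 2, n)]%N ++
  [seq (i, i.+1)%N | i <- iota 2 (n - 4)].

Definition Etilde6 : seq (nat * nat) :=
  [:: (0, 1); (1, 2); (2, 3); (3, 4); (2, 5); (5, 6)]%N.

Definition Etilde7 : seq (nat * nat) :=
  [:: (0, 1); (1, 2); (2, 3); (3, 4); (4, 5); (5, 6); (3, 7)]%N.

Definition Etilde8 : seq (nat * nat) :=
  [:: (0, 1); (1, 2); (2, 3); (3, 4); (4, 5); (5, 6); (6, 7); (2, 8)]%N.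

(** The loop Ã_0 is left out: it has no acyclic orientation. *)
Definition Euclidean (Q : quiver) : Prop :=
  [\/ exists2 n, (1 <= n)%N & underlying_graph_is Q n.+1 (Atilde n),
      exists2 n, (4 <= n)%N & underlying_graph_is Q n.+1 (Dtilde n) |
      [\/ underlying_graph_is Q 7 Etilde6,
          underlying_graph_is Q 8 Etilde7 |
          underlying_graph_is Q 9 Etilde8]].

Definition tame (Q : quiver) : Prop :=
  [/\ qconnected Q, qacyclic Q & Euclidean Q].

(** [pathalg k Q] is the k-vector space with basis the paths of [Q]; [Q] is
    arbitrary here.  It may have no vertex, whence only a [pzRingType]. *)
Definition pathalg (k : fieldType) (Q : quiver) : Type := {malg k[qpath Q]}.

HB.instance Definition _ k Q := GRing.Lmodule.on (pathalg k Q).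

(** The scalar multiple of a basis path; [None] stands for the zero product
    of two paths that cannot be concatenated. *)
Definition pscale (k : fieldType) (Q : quiver) (c : k) (o : option (qpath Q)) :
    pathalg k Q :=
  if o is Some p then << c *g p >> else 0.

Definition pa_one (k : fieldType) (Q : quiver) : pathalg k Q :=
  \sum_(x : vertex Q) << 1 *g path0 x >>.

HB.lock Definition pa_mul (k : fieldType) (Q : quiver) (f g : pathalg k Q) :
    pathalg k Q :=
  \sum_(p <- msupp f) \sum_(q <- msupp g) pscale (f@_p * g@_q) (pcat p q).

Section PathAlgebra.
Variables (k : fieldType) (Q : quiver).
Implicit Types (f g h : pathalg k Q) (p q r : qpath Q) (c d : k).
Implicit Types (o : option (qpath Q)).

Lemma pcatP p q : ptgt p = psrc q ->
  {r : qpath Q | pcat p q = Some r & qpval r = (p.1, p.2 ++ q.2)}.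
Proof.
rewrite /pcat => e0; case: eqP => // e.
by exists (@QPath Q (p.1, p.2 ++ q.2) (pcat_subproof e)).
Qed.

Lemma pcatN p q : ptgt p <> psrc q -> pcat p q = None.
Proof. by rewrite /pcat; case: eqP. Qed.

Lemma ptgt_cat p q r : ptgt p = psrc q -> qpval r = (p.1, p.2 ++ q.2) ->
  ptgt r = ptgt q.
Proof. by move=> e er; rewrite {1}/ptgt er /= map_cat last_cat -/(ptgt p) e. Qed.

Lemma pcatA p q r :
  obind (fun u => pcat u r) (pcat p q) = obind (pcat p) (pcat q r).
Proof.
have [epq|npq] := eqVneq (ptgt p) (psrc q); last first.
  rewrite (pcatN (elimN eqP npq)) /=.
  have [eqr|nqr] := eqVneq (ptgt q) (psrc r); last by rewrite (pcatN (elimN eqP nqr)).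
  have [v -> ev] /= := pcatP eqr.
  by rewrite pcatN // {1}/psrc ev; apply/eqP.
have [u -> eu] /= := pcatP epq.
have tu := ptgt_cat epq eu.
have [eqr|nqr] := eqVneq (ptgt q) (psrc r); last first.
  by rewrite [RHS](_ : _ = None) ?pcatN ?tu ?(pcatN (elimN eqP nqr)) //; apply/eqP.
have [v -> ev] /= := pcatP eqr.
have [w -> ew] := pcatP (etrans tu eqr).
have epv : ptgt p = psrc v by rewrite epq /psrc ev.
have [w' -> ew'] := pcatP epv.
by congr (Some _); apply: val_inj; rewrite /= ew ew' eu ev /= catA.
Qed.

Lemma pcat0p x p : pcat (path0 x) p = if x == psrc p then Some p else None.
Proof.
case: (eqVneq x (psrc p)) => [e|/eqP n]; last by rewrite pcatN.
have [u -> eu] := @pcatP (path0 x) p e.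
by congr (Some _); apply: val_inj; rewrite /= eu /= e /psrc -surjective_pairing.
Qed.

Lemma pcatp0 p x : pcat p (path0 x) = if x == ptgt p then Some p else None.
Proof.
case: (eqVneq x (ptgt p)) => [e|/eqP n]; last by rewrite pcatN // => e; case: n.
have [u -> eu] := @pcatP p (path0 x) (esym e).
by congr (Some _); apply: val_inj; rewrite /= eu /= cats0 -surjective_pairing.
Qed.

Lemma pscale0 o : pscale 0 o = 0 :> pathalg k Q.
Proof. by case: o => //= p; rewrite monalgU0. Qed.

Lemma pscaleD c d o : pscale (c + d) o = pscale c o + pscale d o.
Proof. by case: o => [p|] /=; rewrite ?monalgUD ?addr0. Qed.

Lemma pa_mulw (d1 d2 : {fset qpath Q}) f g :
  (msupp f `<=` d1)%fset -> (msupp g `<=` d2)%fset ->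
  pa_mul f g = \sum_(p <- d1) \sum_(q <- d2) pscale (f@_p * g@_q) (pcat p q).
Proof.
move=> le1 le2; rewrite pa_mul.unlock (big_fset_incl _ le1) /=; last first.
  move=> p _ np; rewrite big1 // => q _.
  by rewrite (mcoeff_outdom np) mul0r pscale0.
apply: eq_bigr => p _; rewrite (big_fset_incl _ le2) //= => q _ nq.
by rewrite (mcoeff_outdom nq) mulr0 pscale0.
Qed.

Lemma pa_mulDl : left_distributive (@pa_mul k Q) +%R.
Proof.
move=> f g h; pose d := (msupp f `|` msupp g)%fset.
have s0 := fsubset_refl (msupp h).
rewrite (@pa_mulw d _ (f + g) h (msuppD_le f g) s0).
rewrite (@pa_mulw d _ f h (fsubsetUl _ _) s0) (@pa_mulw d _ g h (fsubsetUr _ _) s0).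
rewrite -big_split; apply: eq_bigr => p _; rewrite -big_split.
by apply: eq_bigr => q _; rewrite mcoeffD mulrDl pscaleD.
Qed.

Lemma pa_mulDr : right_distributive (@pa_mul k Q) +%R.
Proof.
move=> h f g; pose d := (msupp f `|` msupp g)%fset.
have s0 := fsubset_refl (msupp h).
rewrite (@pa_mulw _ d h (f + g) s0 (msuppD_le f g)).
rewrite (@pa_mulw _ d h f s0 (fsubsetUl _ _)) (@pa_mulw _ d h g s0 (fsubsetUr _ _)).
rewrite -big_split; apply: eq_bigr => p _; rewrite -big_split.
by apply: eq_bigr => q _; rewrite mcoeffD mulrDr pscaleD.
Qed.

Lemma pa_mul0l f : pa_mul 0 f = 0.
Proof. by rewrite pa_mul.unlock msupp0 big_seq_fset0. Qed.

Lemma pa_mul0r f : pa_mul f 0 = 0.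
Proof. by rewrite pa_mul.unlock big1 // => p _; rewrite msupp0 big_seq_fset0. Qed.

Lemma pa_mul_suml I (s : seq I) (P : pred I) (F : I -> pathalg k Q) g :
  pa_mul (\sum_(i <- s | P i) F i) g = \sum_(i <- s | P i) pa_mul (F i) g.
Proof.
by apply: (big_morph (fun f => pa_mul f g)) => [f h|];
  [rewrite pa_mulDl|rewrite pa_mul0l].
Qed.

Lemma pa_mul_sumr I (s : seq I) (P : pred I) (F : I -> pathalg k Q) f :
  pa_mul f (\sum_(i <- s | P i) F i) = \sum_(i <- s | P i) pa_mul f (F i).
Proof.
by apply: (big_morph (pa_mul f)) => [g h|];
  [rewrite pa_mulDr|rewrite pa_mul0r].
Qed.

Lemma pa_mulUU c d p q :
  pa_mul << c *g p >> << d *g q >> = pscale (c * d) (pcat p q).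
Proof.
rewrite (pa_mulw msuppU_le msuppU_le) !big_seq_fset1.
by rewrite !mcoeffUU.
Qed.

Lemma pathalg_ind (P : pathalg k Q -> Prop) :
  P 0 -> (forall f g, P f -> P g -> P (f + g)) ->
  (forall c p, P << c *g p >>) -> forall f, P f.
Proof. by move=> P0 PD PU f; rewrite [f]monalgE; apply: (big_ind P). Qed.

(* The basis elements are abstracted as [U]: unifying two distinct instances of
   << c *g p >> is very slow. *)
Lemma pa_mulA_basis (U : k -> qpath Q -> pathalg k Q) :
  (forall P : pathalg k Q -> Prop, P 0 ->
     (forall f g, P f -> P g -> P (f + g)) -> (forall c p, P (U c p)) ->
     forall f, P f) ->
  (forall c d p q,
     pa_mul (U c p) (U d q) = if pcat p q is Some r then U (c * d) r else 0) ->
  associative (@pa_mul k Q).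
Proof.
move=> ind UU f g h; elim/ind: f => [|f f' IH IH'|c p].
- by rewrite !pa_mul0l.
- by rewrite !pa_mulDl IH IH'.
elim/ind: g => [|g g' IH IH'|d q].
- by rewrite pa_mul0r !pa_mul0l pa_mul0r.
- by rewrite pa_mulDr !pa_mulDl pa_mulDr IH IH'.
elim/ind: h => [|h h' IH IH'|e r].
- by rewrite !pa_mul0r.
- by rewrite !pa_mulDr IH IH'.
rewrite (UU d e q r) (UU c d p q); have := pcatA p q r.
case: (pcat q r) (pcat p q) => [u|] [v|] /= E.
- by rewrite !UU mulrA E.
- by rewrite UU -E pa_mul0l.
- by rewrite UU E pa_mul0r.
by rewrite pa_mul0l pa_mul0r.
Qed.

Lemma pa_mulA : associative (@pa_mul k Q).
Proof. exact: pa_mulA_basis pathalg_ind pa_mulUU. Qed.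

Lemma pa_mul1l : left_id (@pa_one k Q) (@pa_mul k Q).
Proof.
move=> f; elim/pathalg_ind: f => [|f f' IH IH'|c p].
- by rewrite pa_mul0r.
- by rewrite pa_mulDr IH IH'.
rewrite pa_mul_suml (bigD1 (psrc p)) //= big1 => [|x nx].
  by rewrite addr0 pa_mulUU pcat0p eqxx mul1r.
by rewrite pa_mulUU pcat0p (negbTE nx).
Qed.

Lemma pa_mul1r : right_id (@pa_one k Q) (@pa_mul k Q).
Proof.
move=> f; elim/pathalg_ind: f => [|f f' IH IH'|c p].
- by rewrite pa_mul0l.
- by rewrite pa_mulDl IH IH'.
rewrite pa_mul_sumr (bigD1 (ptgt p)) //= big1 => [|x nx].
  by rewrite addr0 pa_mulUU pcatp0 eqxx mulr1.
by rewrite pa_mulUU pcatp0 (negbTE nx).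
Qed.

End PathAlgebra.

HB.instance Definition _ k Q := GRing.Zmodule_isPzRing.Build (pathalg k Q)
  (@pa_mulA k Q) (@pa_mul1l k Q) (@pa_mul1r k Q)
  (@pa_mulDl k Q) (@pa_mulDr k Q).

Definition finitely_generated (R : pzRingType) (M : lmodType R) : Prop :=
  exists (n : nat) (e : 'I_n -> M),
    forall x : M, exists c : 'I_n -> R, x = \sum_i c i *: e i.

(** The objects of the category of finitely generated left [R]-modules; the
    morphisms are the linear maps [{linear M -> N}].  Right [L]-modules are the
    left modules over the converse ring [L^c], so mod-[L] is [fgmod L^c]. *)
Record fgmod (R : pzRingType) := FGMod {
  fgmod_sort :> lmodType R;
  fgmodP : finitely_generated fgmod_sort }.

Section ModuleCategory.
Variable R : pzRingType.
Implicit Types (X Y Z : fgmod R) (C S : fgmod R -> Prop).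

Definition mod_zero X : Prop := forall x : X, x = 0.

Definition mod_iso (M N : lmodType R) : Prop :=
  exists f : {linear M -> N}, bijective f.

Definition hom_zero X Y : Prop := forall (f : {linear X -> Y}) (x : X), f x = 0.

Definition short_exact X Y Z : Prop :=
  exists (f : {linear X -> Y}) (g : {linear Y -> Z}),
    [/\ injective f,
        forall z, exists y, g y = z &
        forall y, g y = 0 <-> exists x, f x = y].

Definition direct_summand X Y : Prop :=
  exists Z : fgmod R, mod_iso (X * Z)%type Y.

Definition iso_closed C : Prop := forall X Y, mod_iso X Y -> C X -> C Y.

(** The zero object is required: it is the empty iterated extension, and it lies
    in every <S> since it is a direct summand of any module. *)
Definition extension_closed C : Prop :=
  (forall X, mod_zero X -> C X) /\
  (forall X Y Z, short_exact X Y Z -> C X -> C Z -> C Y).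

Definition summand_closed C : Prop :=
  forall X Y, direct_summand X Y -> C Y -> C X.

(** The subcategory <S>. *)
Definition generated S : fgmod R -> Prop := fun X =>
  forall C, iso_closed C -> extension_closed C -> summand_closed C ->
    (forall Y, S Y -> C Y) -> C X.

(** [X] has a filtration 0 = F 0 ⊂ ... ⊂ F n = X, with non-zero factors
    F (i+1) / F i in [Pi (phi i)] and phi 0 > ... > phi (n-1).  The inclusions
    are the monomorphisms of the short exact sequences. *)
Definition has_HN_filtration d (Phi : orderType d) (Pi : Phi -> fgmod R -> Prop)
    X : Prop :=
  exists (n : nat) (F : 'I_n.+1 -> fgmod R) (phi : 'I_n -> Phi),
    [/\ mod_zero (F ord0),
        mod_iso (F ord_max) X,
        forall i : 'I_n, exists Y,
          [/\ short_exact (F (widen_ord (leqnSn n) i)) (F (lift ord0 i)) Y,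
              ~ mod_zero Y & Pi (phi i) Y] &
        forall i j : 'I_n, (i < j)%N -> (phi j < phi i)%O].

Record stability_data := StabilityData {
  sd_disp : Order.disp_t;
  phase : orderType sd_disp;
  slice : phase -> fgmod R -> Prop;
  slice_iso : forall a, iso_closed (slice a);
  slice_neq0 : forall a, exists2 X, slice a X & ~ mod_zero X;
  slice_ext : forall a, extension_closed (slice a);
  slice_hom : forall a b, (b < a)%O ->
    forall X Y, slice a X -> slice b Y -> hom_zero X Y;
  slice_HN : forall X, ~ mod_zero X -> has_HN_filtration slice X }.

Definition sd_equivalent (S T : stability_data) : Prop :=
  exists r : phase S -> phase T,
    [/\ bijective r,
        forall a b, (a < b)%O -> (r a < r b)%O &
        forall a X, slice (r a) X <-> slice a X].

Definition sd_finer (T S : stability_data) : Prop :=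
  exists r : phase T -> phase S,
    [/\ forall a, exists b, r b = a,
        forall b b', (b' < b)%O -> (r b' <= r b)%O &
        forall a X, slice a X <->
          generated (fun Y => exists2 b, r b = a & slice b Y) X].

Definition sd_finest (S : stability_data) : Prop :=
  forall T, sd_finer T S -> sd_equivalent T S.

End ModuleCategory.

(* Main.v *)
(** A stability data is determined by the total preorder "phase of X <= phase of
    Y" on its non-zero semistable objects, and a stability data is finer than
    another exactly when its preorder is contained in the other.  A finest
    refinement is thus a minimal preorder below the given one, which Zorn's lemma
    provides once the intersection of a chain of such preorders is known to
    define a stability data again.  Only the existence of Harder-Narasimhan
    filtrations is at stake there: the number of factors in a filtration of [X]
    is bounded, because the path algebra of a finite acyclic quiver is
    finite-dimensional; a filtration with the largest number of factors among all
    members of the chain cannot be refined any more, so its factors are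
    semistable for every finer member. *)

Require Import Defs.
From HB Require Import structures.
From mathcomp Require Import all_boot all_order all_algebra.
From mathcomp Require Import finmap.
From mathcomp.multinomials Require Import monalg.
From mathcomp Require Import boolp classical_sets.
From Stdlib Require List.

Set Implicit Arguments.
Unset Strict Implicit.
Unset Printing Implicit Defensive.

Import Order.TTheory GRing.Theory.
Local Open Scope ring_scope.

(** * Linear maps, kernels and isomorphisms of modules *)

Section Hom.
Variable R : pzRingType.
Implicit Types K L M N : lmodType R.

Lemma linear_pack M N (f : M -> N) :
  (forall a x y, f (a *: x + y) = a *: f x + f y) ->
  exists g : {linear M -> N}, g =1 f.
Proof.
move=> lf; pose m := GRing.isLinear.Build R M N _ f lf.
by exists (HB.pack f m : {linear M -> N}).
Qed.

(** Preimages under the injective [i] are unique, so any choice of them is automatically linear.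
    This serves as the universal property of a submodule. *)
Lemma linear_factor K L M (i : {linear K -> M}) (f : {linear L -> M}) :
  injective i -> (forall x, exists y, i y = f x) ->
  exists g : {linear L -> K}, forall x, i (g x) = f x.
Proof.
move=> inji im; pose g x := projT1 (cid (im x)).
have gE x : i (g x) = f x by rewrite /g; case: cid.
have [|h hE] := @linear_pack L K g.
  by move=> a x y; apply: inji; rewrite linearP !gE linearP.
by exists h => x; rewrite hE.
Qed.

Section Kernel.
Variables (M N : lmodType R) (h : {linear M -> N}).
Definition ker_pred : {pred M} := [pred x | h x == 0].
Fact ker_pred_submod : submod_closed ker_pred.
Proof.
split=> [|a x y]; rewrite !inE ?raddf0 // => /eqP hx /eqP hy.
by rewrite linearP hx hy scaler0 addr0.
Qed.
HB.instance Definition _ := GRing.isSubmodClosed.Build R M ker_pred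
  ker_pred_submod.
Definition ker_type : Type := {x : M | x \in ker_pred}.
HB.instance Definition _ := [isSub of ker_type for @sval M _].
HB.instance Definition _ := [Choice of ker_type by <:].
HB.instance Definition _ := [SubChoice_isSubLmodule of ker_type by <:].
End Kernel.

Lemma kernel_exists M N (h : {linear M -> N}) :
  exists (K : lmodType R) (i : {linear K -> M}), injective i /\
    forall x, h x = 0 <-> exists y, i y = x.
Proof.
exists (ker_type h), (val : {linear ker_type h -> M}); split; first exact: val_inj.
move=> x; split=> [hx|[y <-]]; last exact/eqP/(valP y).
have kx : x \in ker_pred h by rewrite inE hx.
by exists (exist _ x kx : ker_type h).
Qed.

Lemma mod_iso_refl M : mod_iso M M.
Proof. by exists (idfun : {linear M -> M}); exists id. Qed.

Lemma mod_iso_sym M N : mod_iso M N -> mod_iso N M.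
Proof.
move=> [f [g fK gK]].
have injf := can_inj fK.
have [h hE] := @linear_factor M N N f (idfun : {linear N -> N}) injf
  (fun x => ex_intro _ (g x) (gK x)).
by exists h; exists f => x //; apply: injf; rewrite hE.
Qed.

Lemma inj_surj_iso M N (f : {linear M -> N}) :
  injective f -> (forall y, exists x, f x = y) -> mod_iso M N.
Proof.
move=> injf surjf; exists f.
exists (fun y => projT1 (cid (surjf y))) => [x|y]; last by case: cid.
by apply: injf; case: cid.
Qed.
End Hom.

(** * Filtrations with prescribed factors *)

Section Filtration.
Variable R : pzRingType.
Implicit Types (A B C X Y Z : fgmod R) (s t : seq (fgmod R)).

Lemma mod_zero_iso X Y : mod_iso X Y -> mod_zero X -> mod_zero Y.
Proof. by move=> [f [g _ gK]] X0 y; rewrite -(gK y) (X0 (g y)) raddf0. Qed.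

Lemma inj_mod_zero X Y (f : {linear X -> Y}) :
  injective f -> mod_zero Y -> mod_zero X.
Proof. by move=> injf Y0 x; apply: injf; rewrite raddf0. Qed.

Lemma inj_hom_neq0 X Y (f : {linear X -> Y}) :
  injective f -> ~ mod_zero X -> ~ hom_zero X Y.
Proof.
by move=> injf nX h; apply: nX => x; apply: injf; rewrite raddf0; apply: h.
Qed.

Lemma surj_hom_neq0 X Y (f : {linear X -> Y}) :
  (forall y, exists x, f x = y) -> ~ mod_zero Y -> ~ hom_zero X Y.
Proof. by move=> sf nY h; apply: nY => y; have [x <-] := sf y; apply: h. Qed.

Lemma ses_iso_mid A X Y B : mod_iso X Y -> short_exact A X B -> short_exact A Y B.
Proof.
move=> [u bu] [f [g [injf sg ex]]].
have [v bv] : mod_iso Y X by apply: mod_iso_sym; exists u.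
have [w uK wK] := bu.
have [v' [injv' v'E]] : exists v' : {linear Y -> X},
    injective v' /\ forall x, v' (u x) = x.
  have [v' v'E] := @linear_factor _ _ _ _ u (idfun : {linear Y -> Y}) (can_inj uK)
    (fun y => ex_intro _ (w y) (wK y)).
  exists v'; split=> [y y' e|x]; last by apply: (can_inj uK); rewrite v'E.
  by have := congr1 u e; rewrite !v'E.
exists (u \o f : {linear A -> Y}), (g \o v' : {linear Y -> B}); split=> /=.
- by apply: inj_comp injf; apply: can_inj uK.
- by move=> z; have [x <-] := sg z; exists (u x); rewrite v'E.
move=> y; rewrite ex; split=> [[a fa]|[a <-]]; exists a.
  by apply: injv'; rewrite v'E.
by rewrite v'E.
Qed.

Lemma ses_iso_sub A A' X B : mod_iso A' A -> short_exact A X B -> short_exact A' X B.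
Proof.
move=> [u [w uK wK]] [f [g [injf sg ex]]].
exists (f \o u : {linear A' -> X}), g; split=> //.
  exact: inj_comp injf (can_inj uK).
move=> y; rewrite ex; split=> -[a <-]; first by exists (w a); rewrite /= wK.
by exists (u a).
Qed.

Lemma ses_zero_quot A X B : mod_zero B -> short_exact A X B -> mod_iso A X.
Proof.
move=> B0 [f [g [injf sg ex]]]; apply: (inj_surj_iso injf) => x.
by apply/ex; apply: B0.
Qed.

Lemma ses_zero_sub A X B : mod_zero A -> short_exact A X B -> mod_iso X B.
Proof.
move=> A0 [f [g [injf sg ex]]]; apply: (@inj_surj_iso _ _ _ g _ sg) => x y e.
have /ex[a fa] : g (x - y) = 0; first by rewrite linearB e subrr.
by apply/eqP; rewrite -subr_eq0 -fa (A0 a) raddf0.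
Qed.

(** Generators of [L], together with lifts of generators of [N], generate [M]. The lemma serves to
    show that certain submodules are again objects of [fgmod R]. *)
Lemma ses_finitely_generated (L M N : lmodType R) (f : {linear L -> M})
    (g : {linear M -> N}) :
  (forall z, exists y, g y = z) -> (forall y, g y = 0 -> exists x, f x = y) ->
  finitely_generated L -> finitely_generated N -> finitely_generated M.
Proof.
move=> sg ex [n [e eP]] [m [e' e'P]].
have [w wP] : exists w : 'I_m -> M, forall j, g (w j) = e' j.
  by exists (fun j => projT1 (cid (sg (e' j)))) => j; case: cid.
exists (n + m)%N, (fun i => match split i with inl j => f (e j) | inr j => w j end).
move=> x; have [c' c'E] := e'P (g x).
have /ex[a fa] : g (x - \sum_j c' j *: w j) = 0.
  rewrite linearB linear_sum {1}c'E; apply/eqP; rewrite subr_eq0; apply/eqP.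
  by apply: eq_bigr => j _; rewrite linearZ wP.
have [c cE] := eP a.
exists (fun i => match split i with inl j => c j | inr j => c' j end).
rewrite big_split_ord /=; have -> : x = f a + \sum_j c' j *: w j.
  by rewrite fa subrK.
congr (_ + _); last by apply: eq_bigr => j _; rewrite (unsplitK (inr j)).
rewrite cE linear_sum; apply: eq_bigr => j _.
by rewrite (unsplitK (inl j)) linearZ.
Qed.

(* The middle term is the preimage in [X] of [A'], a submodule of [A]. *)
Lemma ses_assoc X' X A A' B : short_exact X' X A -> short_exact A' A B ->
  exists2 X'', short_exact X' X'' A' & short_exact X'' X B.
Proof.
move=> [f [g [injf sg exg]]] [u [v [inju sv exv]]].
have [K [i [inji iP]]] := kernel_exists (v \o g : {linear X -> B}).
have [y|f' f'E] := @linear_factor _ K X' X i f inji.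
  by apply/iP => /=; have /exg -> : exists x, f x = f y; [exists y|rewrite raddf0].
have [y|g' g'E] := @linear_factor _ A' K A u (g \o i : {linear K -> A}) inju.
  by apply/exv; apply/(iP (i y)); exists y.
have sg' a : exists y, g' y = a.
  have [x gx] := sg (u a).
  have /iP[y iy] : (v \o g : {linear X -> B}) x = 0.
    by rewrite /= gx; apply/exv; exists a.
  by exists y; apply: inju; rewrite g'E /= iy.
have ex' y : g' y = 0 <-> exists x, f' x = y.
  split=> [g'y|[x <-]].
    have /exg[x fx] : g (i y) = 0 by have:= g'E y; rewrite g'y raddf0 /= => <-.
    by exists x; apply: inji; rewrite f'E.
  by apply: inju; rewrite g'E /= f'E raddf0; apply/exg; exists x.
(* As a mere submodule of [X], [K] need not be an object; it is one because it is an extension of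
   [A'] by [X']. *)
have fgK : finitely_generated K.
  by apply: (@ses_finitely_generated _ _ _ f' g') => //;
    [move=> y /ex'|exact: fgmodP|exact: fgmodP].
exists (FGMod fgK).
  exists f', g'; split=> // x y e; apply: injf.
  by rewrite -!f'E e.
exists i, (v \o g : {linear X -> B}); split=> //.
move=> b; have [a <-] := sv b; have [x <-] := sg a; by exists x.
Qed.

(* The factors are listed from the top one to the bottom one. *)
Fixpoint filt s X : Prop :=
  if s is B :: s' then exists2 X', short_exact X' X B & filt s' X' else mod_zero X.

Lemma filt_iso s X Y : mod_iso X Y -> filt s X -> filt s Y.
Proof.
case: s => [|B s] iXY /=; first exact: mod_zero_iso.
by move=> [X' e h]; exists X' => //; apply: ses_iso_mid e.
Qed.

(** The filtration of the quotient [A] is pulled back to [X] one step at a time with [ses_assoc];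
    its factors lie on top, so they come first in the list. *)
Lemma filt_cat s t X' X A :
  short_exact X' X A -> filt t A -> filt s X' -> filt (t ++ s) X.
Proof.
elim: t X A => [|B t IH] X A eX /= => [A0 |[A' eA hA']] hX'.
  by apply: filt_iso hX'; apply: ses_zero_quot eX.
have [X'' e1 e2] := ses_assoc eX eA.
by exists X'' => //; apply: IH e1 hA' hX'.
Qed.

Lemma filt1 B X : filt [:: B] X -> mod_iso X B.
Proof. by move=> [X' e X0]; apply: ses_zero_sub e. Qed.

Lemma filt_rcons_sub s B X : filt (rcons s B) X ->
  exists f : {linear B -> X}, injective f.
Proof.
elim: s X => [|C s IH] X /=.
  by move=> /filt1/mod_iso_sym[f bf]; exists f; apply: bij_inj.
move=> [X' [f [_ [injf _ _]]]] /IH[g injg].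
by exists (f \o g : {linear B -> X}); apply: inj_comp.
Qed.

Lemma filt_closed (C : fgmod R -> Prop) s X :
  extension_closed C -> List.Forall C s -> filt s X -> C X.
Proof.
move=> [C0 Cext]; elim: s X => [|B s IH] X; first by move=> _; apply: C0.
move=> /List.Forall_cons_iff[CB Cs] /= [X' e h].
by apply: Cext e _ CB; apply: IH.
Qed.

Lemma generated_ext (C : fgmod R -> Prop) : extension_closed (generated C).
Proof.
split=> [X X0 D _ [D0 _] _ _|X Y Z e hX hZ D iD [D0 De] sD CD]; first exact: D0.
by apply: (De _ _ _ e); [apply: hX|apply: hZ].
Qed.
End Filtration.

(** * Semistability preorders *)

Section SemistableOrder.
Variable R : pzRingType.
Implicit Types (A B C X Y Z : fgmod R) (s t : seq (fgmod R)).
Implicit Types P Q : fgmod R -> fgmod R -> Prop.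

Definition rlt P X Y : Prop := P X Y /\ ~ P Y X.
Definition req P X Y : Prop := P X Y /\ P Y X.

(** Since factors are listed from the top, the Harder-Narasimhan condition becomes a strict increase
    of phases along the list. *)
Fixpoint ascending P s : Prop :=
  if s is B :: s' then
    [/\ P B B, List.Forall (rlt P B) s' & ascending P s']
  else True.

(* Stability data are encoded by the total preorder [P X Y] on the non-zero
   semistable objects (those with [P X X]) comparing phases. *)
Record semistable_order P : Prop := SemistableOrder {
  so_refl : forall X Y, P X Y -> P X X /\ P Y Y;
  so_neq0 : forall X, P X X -> ~ mod_zero X;
  so_total : forall X Y, P X X -> P Y Y -> P X Y \/ P Y X;
  so_trans : forall X Y Z, P X Y -> P Y Z -> P X Z;
  so_iso : forall X Y, mod_iso X Y -> P X X -> P Y Y;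
  so_ext : forall X Y Z, short_exact X Y Z -> req P X Z -> P Y Y;
  so_hom : forall X Y, P X X -> P Y Y -> ~ hom_zero X Y -> P X Y;
  so_HN : forall X, ~ mod_zero X -> exists2 s, ascending P s & filt s X }.

Definition suborder P Q : Prop := forall X Y, P X Y -> Q X Y.

Lemma so_req_iso P X Y : semistable_order P -> mod_iso X Y -> P X X -> req P X Y.
Proof.
move=> oP iXY PX; have PY := so_iso oP iXY PX.
have [g bg] := mod_iso_sym iXY; have [f bf] := iXY.
split; apply: (so_hom oP) => //.
  exact: (@inj_hom_neq0 _ _ _ f (bij_inj bf) (so_neq0 oP PX)).
exact: (@inj_hom_neq0 _ _ _ g (bij_inj bg) (so_neq0 oP PY)).
Qed.

Lemma so_rltN P X Y : semistable_order P -> P X X -> P Y Y -> ~ P Y X -> rlt P X Y.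
Proof. by move=> oP PX PY n; split=> //; have [] := so_total oP PX PY. Qed.

Lemma suborder_rlt P Q X Y : semistable_order P -> suborder P Q ->
  P X X -> P Y Y -> rlt Q X Y -> rlt P X Y.
Proof. by move=> oP PQ PX PY [_ n]; apply: so_rltN => // /PQ. Qed.

Lemma ascending_self P s : ascending P s -> List.Forall (fun B => P B B) s.
Proof. by elim: s => //= B s IH [PB _ /IH]; constructor. Qed.

Lemma ascending_cat P s t : ascending P s -> ascending P t ->
  List.Forall (fun B => List.Forall (rlt P B) t) s -> ascending P (s ++ t).
Proof.
move=> + at_; elim: s => //= B s IH [PB Bs /IH{}IH].
move=> /List.Forall_cons_iff[Bt st]; split=> //; last exact: IH.
by apply/List.Forall_app.
Qed.

Lemma ascending_head P B s : ascending P (B :: s) -> List.Forall (P B) (B :: s).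
Proof.
by move=> [PB Bs _]; constructor => //; apply: List.Forall_impl Bs => C [].
Qed.

Lemma ascending_last P s C : ascending P (rcons s C) ->
  List.Forall (fun B => P B C) (rcons s C).
Proof.
elim: s => [|B s IH] /=; first by move=> [PC _ _]; constructor.
move=> [PB]; rewrite -{1}cats1 => /List.Forall_app[_].
by move=> /List.Forall_cons_iff[[BC _] _] /IH; constructor.
Qed.

(** The top factor is a quotient of [Y], hence lies above [Y] for [Q], and the bottom factor embeds
    in [Y], hence lies below it; since phases increase towards the top factor only down the list,
    all factors are squeezed onto the phase of [Y]. It is used for [X = Y] and for [X] a direct
    summand of [Y]. *)
Lemma factors_req P Q s X Y : semistable_order P -> semistable_order Q ->
  suborder P Q -> Q Y Y ->
  (exists g : {linear Y -> X}, forall x, exists y, g y = x) ->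
  (exists f : {linear X -> Y}, injective f) ->
  ascending P s -> filt s X -> List.Forall (req Q Y) s.
Proof.
move=> oP oQ PQ QY [g sg] [f injf] ascs fs.
have ss := ascending_self ascs.
apply: List.Forall_and.
  case: s ascs fs ss => [|B s] // ascs [X' [_ [h [_ sh _]]] _].
  move=> /List.Forall_cons_iff[PB _].
  have YB : Q Y B.
    apply: (so_hom oQ) => //; first exact: PQ.
    apply: (@surj_hom_neq0 _ _ _ (h \o g : {linear Y -> B})).
      by move=> b; have [x <-] := sh b; have [y <-] := sg x; exists y.
    exact: (so_neq0 oP PB).
  by apply: List.Forall_impl (ascending_head ascs) => C /PQ; apply: (so_trans oQ).
case/lastP: s ascs fs ss => // s B ascs /filt_rcons_sub[h injh].
rewrite -{1}cats1 => /List.Forall_app[_ /List.Forall_cons_iff[PB _]].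
have BY : Q B Y.
  apply: (so_hom oQ) => //; first exact: PQ.
  apply: (@inj_hom_neq0 _ _ _ (f \o h : {linear B -> Y})).
    exact: inj_comp.
  exact: (so_neq0 oP PB).
apply: List.Forall_impl (ascending_last ascs) => C /PQ CB.
exact: (so_trans oQ CB BY).
Qed.

Lemma factors_req_id P Q s X : semistable_order P -> semistable_order Q ->
  suborder P Q -> Q X X -> ascending P s -> filt s X -> List.Forall (req Q X) s.
Proof.
move=> oP oQ PQ QX; apply: (factors_req oP oQ PQ QX).
  by exists (idfun : {linear X -> X}) => x; exists x.
by exists (idfun : {linear X -> X}) => x y.
Qed.

Lemma size_le1_self P s X : semistable_order P -> ~ mod_zero X ->
  ascending P s -> filt s X ->
  (0 < size s)%N /\ ((size s <= 1)%N -> P X X).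
Proof.
case: s => [|B [|C s]] //= oP nX [PB _ _] hX; split=> // _.
by apply: (so_iso oP) PB; apply: mod_iso_sym; apply: filt1 hX.
Qed.

(** Every factor is replaced by its own filtration for [P], whose factors keep the [Q]-phase of the
    original, so that strict comparisons between blocks survive. The last clause strengthens the
    induction: it compares the refined lower part with a factor put on top. *)
Lemma refine_filt P Q s X : semistable_order P -> semistable_order Q ->
  suborder P Q -> ascending Q s -> filt s X ->
  exists t, [/\ ascending P t, filt t X, (size s <= size t)%N,
    (size t <= size s)%N -> List.Forall (fun B => P B B) s &
    forall Z, P Z Z -> List.Forall (rlt Q Z) s -> List.Forall (rlt P Z) t].
Proof.
move=> oP oQ PQ; elim: s X => [|A s IH] X; first by exists [::].
move=> [QA As /IH{}IH] [X' e /IH[t [asct ft sst ts tP]]].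
have nA := so_neq0 oQ QA.
have [u ascu fu] := so_HN oP nA.
have [u0 u1] := size_le1_self oP nA ascu fu.
have uA := factors_req_id oP oQ PQ QA ascu fu.
have Pu := ascending_self ascu.
exists (u ++ t); split.
- apply: ascending_cat => //.
  apply: List.Forall_impl (List.Forall_and uA Pu) => B [[AB BA] PB].
  apply: tP => //; apply: List.Forall_impl As => C [AC nCA]; split.
    exact: (so_trans oQ BA AC).
  by move=> CB; apply/nCA/(so_trans oQ CB).
- exact: filt_cat e _ _.
- by rewrite size_cat /= -add1n leq_add.
- rewrite size_cat /= => le; constructor.
    apply: u1; rewrite leqNgt; apply/negP => lt1.
    (* Two or more pieces in [u] would make the refinement strictly longer than the original
       list. *)
    by have := leq_add lt1 sst; rewrite add2n => /leq_trans/(_ le); rewrite ltnn.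
  apply: ts; have := leq_trans (leq_add u0 (leqnn _)) le.
  by rewrite add1n ltnS.
move=> Z PZ /List.Forall_cons_iff[ZA Zs]; apply/List.Forall_app; split.
  apply: List.Forall_impl (List.Forall_and uA Pu) => B [[AB BA] PB].
  apply: (suborder_rlt oP PQ) => //; case: ZA => ZA nAZ; split.
    exact: (so_trans oQ ZA AB).
  by move=> BZ; apply/nAZ/(so_trans oQ AB).
exact: tP.
Qed.

Definition bounded_length : Prop := forall X, exists N, forall s,
  List.Forall (fun B => ~ mod_zero B) s -> filt s X -> (size s <= N)%N.

(* A filtration of maximal length among those of all members of the chain has
   factors that are semistable for every finer member. *)
Lemma chain_inter (CC : (fgmod R -> fgmod R -> Prop) -> Prop) :
  bounded_length -> (exists P, CC P) ->
  (forall P, CC P -> semistable_order P) ->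
  (forall P Q, CC P -> CC Q -> suborder P Q \/ suborder Q P) ->
  semistable_order (fun X Y => forall P, CC P -> P X Y).
Proof.
move=> bl [P0 CP0] CO tot; split.
- by move=> X Y h; split=> P CP; have [] := so_refl (CO _ CP) (h _ CP).
- by move=> X h; apply: (so_neq0 (CO _ CP0)) (h _ CP0).
- move=> X Y hX hY.
  (* If the comparison fails at [P], the reverse one holds at [P] and passes to larger members; at
     smaller members the comparison fails too, so totality gives the reverse. *)
  have [|/existsNP[P /not_implyP[CP nP]]] := pselect (forall P, CC P -> P X Y).
    by left.
  have PYX : P Y X by have [] := so_total (CO _ CP) (hX _ CP) (hY _ CP).
  right=> Q CQ; have [PQ|QP] := tot _ _ CP CQ; first exact: PQ.
  by have [/QP//|//] := so_total (CO _ CQ) (hX _ CQ) (hY _ CQ).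
- by move=> X Y Z h1 h2 P CP; apply: (so_trans (CO _ CP) (h1 _ CP) (h2 _ CP)).
- by move=> X Y i h P CP; apply: (so_iso (CO _ CP) i (h _ CP)).
- move=> X Y Z e [h1 h2] P CP.
  by apply: (so_ext (CO _ CP) e); split; [apply: h1|apply: h2].
- by move=> X Y hX hY n P CP; apply: (so_hom (CO _ CP)) => //; [apply: hX|apply: hY].
move=> X nX; have [N NP] := bl X.
pose good n := exists P s, [/\ CC P, ascending P s, filt s X & size s = n].
have good_le n : `[< good n >] -> (n <= N)%N.
  move=> /asboolP[P [s [CP ascs fs <-]]]; apply: NP fs.
  by apply: List.Forall_impl (ascending_self ascs) => B /(so_neq0 (CO _ CP)).
have ex_good : exists n, `[< good n >].
  have [s ascs fs] := so_HN (CO _ CP0) nX.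
  by exists (size s); apply/asboolP; exists P0, s.
case: (ex_maxnP ex_good good_le) => n /asboolP[P [s [CP ascs fs sn]]] maxn.
(* For a finer [Q], the refinement of [s] is again a candidate, so it is no longer than [s]; hence
   no factor was split and all are semistable for [Q]. *)
have ss : List.Forall (fun B => forall Q, CC Q -> Q B B) s.
  apply/List.Forall_forall => B Bs Q CQ.
  have PB := List.Forall_forall _ s; have {PB}[PB _] := PB (fun B => P B B).
  have {}PB := PB (ascending_self ascs) _ Bs.
  have [PQ|QP] := tot _ _ CP CQ; first exact: PQ.
  have [t [asct ft st ts _]] := refine_filt (CO _ CQ) (CO _ CP) QP ascs fs.
  have /ts/List.Forall_forall : (size t <= size s)%N.
    by rewrite sn; apply: maxn; apply/asboolP; exists Q, t.
  exact.
exists s => //; elim: s ascs ss {fs sn} => //= B s IH [PB Bs /IH{}IH].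
move=> /List.Forall_cons_iff[hB ss]; split=> //; last exact: IH.
apply: List.Forall_impl (List.Forall_and Bs ss) => C [[BC nCB] hC].
split=> [Q CQ|/(_ _ CP)//].
have [PQ|QP] := tot _ _ CP CQ; first exact: PQ.
by have [//|/QP] := so_total (CO _ CQ) (hB _ CQ) (hC _ CQ).
Qed.
End SemistableOrder.

(** * The preorder of a stability data *)

Section StabilityData.
Variable R : pzRingType.
Implicit Types (A B C X Y Z : fgmod R) (s t : seq (fgmod R)).
Implicit Types S T : stability_data R.

(** The zero module lies in every slice; excluding it makes the phase of an object well defined. *)
Definition phase_le S X Y : Prop :=
  [/\ ~ mod_zero X, ~ mod_zero Y &
      exists a b : phase S, [/\ (a <= b)%O, slice a X & slice b Y]].

(** Otherwise the identity of [X] would be a non-zero map from a higher to a lower phase. *)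
Lemma phase_unique S (a b : phase S) X :
  slice a X -> slice b X -> ~ mod_zero X -> a = b.
Proof.
move=> aX bX nX; case: (ltgtP a b) => // lt; case: nX => x.
  exact: (slice_hom lt bX aX (idfun : {linear X -> X}) x).
exact: (slice_hom lt aX bX (idfun : {linear X -> X}) x).
Qed.

Lemma phase_le_slice S X Y (a b : phase S) : phase_le S X Y ->
  slice a X -> slice b Y -> (a <= b)%O.
Proof.
move=> [nX nY [a' [b' [le a'X b'Y]]]] aX bY.
by rewrite (phase_unique aX a'X nX) (phase_unique bY b'Y nY).
Qed.

Lemma phase_le_refl S X (a : phase S) : slice a X -> ~ mod_zero X -> phase_le S X X.
Proof. by move=> aX nX; split=> //; exists a, a. Qed.

Lemma phase_req_slice S X Y (a : phase S) : req (phase_le S) X Y ->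
  slice a X -> slice a Y.
Proof.
move=> [XY YX] aX; have [_ _ [b [c [bc bX cY]]]] := XY.
suff -> : a = c by [].
by apply/eqP; rewrite eq_le (phase_le_slice XY aX cY) (phase_le_slice YX cY aX).
Qed.

Lemma short_exact_neq0 X Y Z : short_exact X Y Z -> ~ mod_zero X -> ~ mod_zero Y.
Proof. by move=> [f [g [injf _ _]]] nX /(inj_mod_zero injf). Qed.

Lemma HN_ascending S X : has_HN_filtration (@slice _ S) X ->
  exists2 s, ascending (phase_le S) s & filt s X.
Proof.
move=> [n [F [phi [F0 FX Fses dphi]]]].
(* The induction runs over the terms of the filtration and records that the factors so far have
   phases [phi j] with [j < m]; the next factor, of smaller phase, goes to the front of the list. *)
suff H m (ltm : (m < n.+1)%N) : exists s, [/\ ascending (phase_le S) s,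
    filt s (F (Ordinal ltm)) & List.Forall (fun B => ~ mod_zero B /\
      exists2 j : 'I_n, (j < m)%N & slice (phi j) B) s].
  have [s [ascs fs _]] := H n (ltnSn n); exists s => //.
  apply: filt_iso FX _; rewrite (_ : ord_max = Ordinal (ltnSn n)) //.
elim: m ltm => [|m IH] ltm.
  by exists [::]; split=> //=; rewrite (_ : Ordinal _ = ord0) //; apply: val_inj.
have [s [ascs fs ps]] := IH (ltnW ltm).
pose i := Ordinal (ltm : (m < n)%N).
have [B [e nB iB]] := Fses i.
exists (B :: s); split=> /=.
- split=> //; first exact: phase_le_refl iB nB.
  apply: List.Forall_impl ps => C [nC [j ltj jC]].
  have ltp : (phi i < phi j)%O by apply: dphi.
  split; first by split=> //; exists (phi i), (phi j); rewrite ltW.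
  by move=> /phase_le_slice/(_ jC iB); rewrite leNgt ltp.
- exists (F (Ordinal (ltnW ltm))) => //.
  rewrite (_ : Ordinal (ltnW ltm) = widen_ord (leqnSn n) i); last exact: val_inj.
  by rewrite (_ : Ordinal ltm = lift ord0 i) //; apply: val_inj.
constructor; first by split=> //; exists i.
apply: List.Forall_impl ps => C [nC [j ltj jC]]; split=> //.
by exists j => //; apply: ltnW.
Qed.

Lemma phase_le_order S : semistable_order (phase_le S).
Proof.
split.
- move=> X Y [nX nY [a [b [_ aX bY]]]].
  by split; [apply: phase_le_refl aX nX|apply: phase_le_refl bY nY].
- by move=> X [].
- move=> X Y [nX _ [a [_ [_ aX _]]]] [nY _ [b [_ [_ bY _]]]].
  by case/orP: (le_total a b) => le; [left|right]; split=> //;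
    [exists a, b|exists b, a].
- move=> X Y Z [nX nY [a [b [ab aX bY]]]] YZ.
  have [_ nZ [_ [c [_ _ cZ]]]] := YZ; split=> //; exists a, c; split=> //.
  exact: le_trans ab (phase_le_slice YZ bY cZ).
- move=> X Y i [nX _ [a [_ [_ aX _]]]].
  apply: (@phase_le_refl _ _ a); first exact: slice_iso i aX.
  by move/(mod_zero_iso (mod_iso_sym i)).
- move=> X Y Z e r; have [[nX _ [a [_ [_ aX _]]]] _] := r.
  have aZ := phase_req_slice r aX.
  apply: (@phase_le_refl _ _ a); last exact: short_exact_neq0 e nX.
  by have [_ sx] := slice_ext a; apply: sx e aX aZ.
- move=> X Y [nX _ [a [_ [_ aX _]]]] [nY _ [b [_ [_ bY _]]]] nh.
  split=> //; exists a, b; split=> //; rewrite leNgt; apply/negP => lt.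
  by apply: nh; apply: slice_hom lt _ _ aX bY.
by move=> X nX; apply: HN_ascending; apply: slice_HN.
Qed.

(** A summand [X] of [Y] is both a quotient and a submodule of [Y], so by [factors_req] its
    Harder-Narasimhan factors all have the phase of [Y]; then [X] is an iterated extension of
    objects of the slice. *)
Lemma slice_summand S (a : phase S) : summand_closed (slice a).
Proof.
move=> X Y [Z [u bu]] aY.
have [X0|nX] := pselect (mod_zero X); first by have [s0 _] := slice_ext a; apply: s0.
have oS := phase_le_order S.
have [s ascs fs] := so_HN oS nX.
have [v vK Kv] := bu.
have [w bw] : mod_iso Y (X * Z)%type by apply: mod_iso_sym; exists u.
have [w' w'K Kw'] := bw.
have [|i iE] := @linear_pack _ X (X * Z)%type (fun x => (x, 0)).
  by move=> c x y; congr pair; rewrite /= scaler0 addr0.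
have injui : injective (u \o i : {linear X -> Y}).
  by move=> x y /(can_inj vK); rewrite !iE => -[].
have nY : ~ mod_zero Y by move/(inj_mod_zero injui).
apply: (filt_closed _ _ fs); first exact: slice_ext.
have : List.Forall (req (phase_le S) Y) s.
  apply: (factors_req oS oS _ _ _ _ ascs fs) => //.
  - exact: phase_le_refl aY nY.
  - exists (fst \o w : {linear Y -> X}) => x; exists (w' (x, 0)).
    by rewrite /= Kw'.
  by exists (u \o i : {linear X -> Y}).
by apply: List.Forall_impl => B r; apply: phase_req_slice r aY.
Qed.

Lemma generated_slice S (a : phase S) (C : fgmod R -> Prop) X :
  (forall Y, C Y -> slice a Y) -> generated C X -> slice a X.
Proof.
move=> CS; apply; [exact: slice_iso|exact: slice_ext|exact: slice_summand|exact: CS].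
Qed.

Lemma finer_phase_le S T : sd_finer T S -> suborder (phase_le T) (phase_le S).
Proof.
move=> [r [_ mr gr]] X Y [nX nY [a [b [le aX bY]]]].
have sl c Z : slice c Z -> slice (r c) Z.
  by move=> cZ; apply/gr => D _ _ _; apply; exists c.
split=> //; exists (r a), (r b); split; [|exact: sl|exact: sl].
by move: le; rewrite le_eqVlt => /orP[/eqP->//|/mr].
Qed.

(** Each slice of [T] lies in a single slice of [S], which defines [r]. Conversely, the [T]-factors
    of an object of [slice a] lie in slices over [a]; this gives both surjectivity of [r] and
    generation. *)
Lemma phase_le_finer S T : suborder (phase_le T) (phase_le S) -> sd_finer T S.
Proof.
move=> TS; have oT := phase_le_order T; have oS := phase_le_order S.
have ex_r (b : phase T) : exists a : phase S, forall X, slice b X -> slice a X.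
  have [X bX nX] := slice_neq0 b.
  have [_ _ [a [_ [_ aX _]]]] := TS _ _ (phase_le_refl bX nX).
  exists a => Y bY; have [Y0|nY] := pselect (mod_zero Y).
    by have [s0 _] := slice_ext a; apply: s0.
  by apply: phase_req_slice aX; split; apply: TS; split=> //; exists b, b.
pose r b := projT1 (cid (ex_r b)).
have rP b X : slice b X -> slice (r b) X by rewrite /r; case: cid => a h /h.
have ex_slice (a : phase S) X s : slice a X -> ~ mod_zero X ->
    ascending (phase_le T) s -> filt s X ->
    List.Forall (fun B => exists2 b, r b = a & slice b B) s.
  move=> aX nX ascs fs.
  have h := factors_req_id oT oS TS (phase_le_refl aX nX) ascs fs.
  apply: List.Forall_impl (List.Forall_and h (ascending_self ascs)).
  move=> B [XB [nB _ [b [_ [_ bB _]]]]]; exists b => //.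
  exact: phase_unique (rP _ _ bB) (phase_req_slice XB aX) nB.
exists r; split.
- move=> a; have [X aX nX] := slice_neq0 a; have [s ascs fs] := so_HN oT nX.
  case: s ascs fs => [|B s] ascs fs; first by case: nX.
  have /List.Forall_cons_iff[[b rb _] _] := ex_slice a X _ aX nX ascs fs.
  by exists b.
- move=> b b' lt; have [X bX nX] := slice_neq0 b; have [Y b'Y nY] := slice_neq0 b'.
  apply: (@phase_le_slice S Y X); [|exact: rP|exact: rP].
  by apply: TS; split=> //; exists b', b; rewrite ltW.
move=> a X; split=> [aX|]; last first.
  by apply: generated_slice => Y [b <-]; apply: rP.
have [X0|nX] := pselect (mod_zero X).
  by have [g0 _] := generated_ext (fun Y => exists2 b, r b = a & slice b Y);
    apply: g0.
have [s ascs fs] := so_HN oT nX.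
apply: (filt_closed _ _ fs); first exact: generated_ext.
apply: List.Forall_impl (ex_slice a X s aX nX ascs fs) => B CB D _ _ _; exact.
Qed.

(** Objects of two [T]-phases with the same image under [r] have equal [S]-phase, hence equal
    [T]-phase, so [r] is injective. *)
Lemma finer_equivalent S T : sd_finer T S -> suborder (phase_le S) (phase_le T) ->
  sd_equivalent T S.
Proof.
move=> TS ST; have [r [sr mr gr]] := TS.
have sl c Z : slice c Z -> slice (r c) Z.
  by move=> cZ; apply/gr => D _ _ _; apply; exists c.
have injr : injective r.
  move=> b b' e; have [X bX nX] := slice_neq0 b; have [Y b'Y nY] := slice_neq0 b'.
  have XY : req (phase_le T) X Y.
    split; apply: ST; split=> //; exists (r b), (r b); split=> //;
      rewrite ?[in slice _ Y]e; exact: sl.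
  exact: phase_unique (phase_req_slice XY bX) b'Y nY.
exists r; split.
- exists (fun a => projT1 (cid (sr a))) => [b|a]; last by case: cid.
  by apply: injr; case: cid.
- by move=> a b lt; rewrite lt_neqAle mr // (inj_eq injr) lt_eqF.
move=> b X; split=> [rbX|]; last exact: sl.
have [X0|nX] := pselect (mod_zero X).
  by have [s0 _] := slice_ext b; apply: s0.
have [_ _ [b' [_ [_ b'X _]]]] := ST _ _ (phase_le_refl rbX nX).
suff <- : b' = b by [].
by apply: injr; apply: phase_unique (sl _ _ b'X) rbX nX.
Qed.
End StabilityData.

(** * The stability data of a preorder *)

Section Presentation.
Variable R : pzRingType.
Implicit Types X Y : fgmod R.

(** A number of generators and the set of all their relations: a code for a module up to isomorphism
    that mentions no module. *)
Definition presentation : Type := {n : nat & ('I_n -> R) -> Prop}.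

Definition presents X (c : presentation) : Prop :=
  exists e : 'I_(projT1 c) -> X,
    (forall x, exists a : 'I_(projT1 c) -> R, x = \sum_i a i *: e i) /\
    (forall a, projT2 c a <-> \sum_i a i *: e i = 0).

Lemma presentation_exists X : exists c, presents X c.
Proof.
have [n [e eP]] := fgmodP X.
by exists (existT _ n (fun a => \sum_i a i *: e i = 0)), e.
Qed.

(** Two combinations of the generators agree in [X] exactly when they agree in [Y], so sending
    coordinates to coordinates does not depend on their choice. *)
Lemma presents_iso X Y c : presents X c -> presents Y c -> mod_iso X Y.
Proof.
case: c => n N [e /= [eP eN]] [e' /= [e'P e'N]].
pose co x := projT1 (cid (eP x)).
have coP x : x = \sum_i co x i *: e i by rewrite /co; case: cid.
have sub0 (V : lmodType R) (u : 'I_n -> V) (a b : 'I_n -> R) :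
    \sum_i a i *: u i - \sum_i b i *: u i = \sum_i (a i - b i) *: u i.
  by rewrite -sumrB; apply: eq_bigr => i _; rewrite scalerBl.
have same (a b : 'I_n -> R) : \sum_i a i *: e i = \sum_i b i *: e i <->
    \sum_i a i *: e' i = \sum_i b i *: e' i.
  by split=> /eqP; rewrite -subr_eq0 sub0 => /eqP;
    [move/eN/e'N|move/e'N/eN]; rewrite -sub0 => /eqP; rewrite subr_eq0 => /eqP.
have [|f fE] := @linear_pack _ X Y (fun x => \sum_i co x i *: e' i).
  move=> a x y; rewrite scaler_sumr -big_split /=.
  transitivity (\sum_i (a * co x i + co y i) *: e' i); last first.
    by apply: eq_bigr => i _; rewrite scalerDl scalerA.
  apply/same; rewrite -coP {1}(coP x) {1}(coP y) scaler_sumr -big_split /=.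
  by apply: eq_bigr => i _; rewrite scalerDl scalerA.
apply: (@inj_surj_iso _ _ _ f).
  by move=> x y; rewrite !fE => /same; rewrite -!coP.
move=> y; have [a ->] := e'P y; exists (\sum_i a i *: e i).
by rewrite fE; apply/same; rewrite -coP.
Qed.
End Presentation.

(** * Phases and slices built from a semistability preorder *)

Section Realization.
Variables (R : pzRingType) (P : fgmod R -> fgmod R -> Prop).
Hypothesis oP : semistable_order P.
Implicit Types (X Y Z : fgmod R) (s : seq (fgmod R)).

Definition phase_class X : presentation R -> Prop :=
  fun c => exists2 Y, req P X Y & presents Y c.

(* The universe of the phases of a stability data is too small to contain sets
   of modules, so that phases are sets of presentations instead. *)
Definition class_phase_of (_ : semistable_order P) : Type :=
  {p : presentation R -> Prop | exists2 X, P X X & p = phase_class X}.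

Local Notation class_phase := (class_phase_of oP).

(** If the classes agree, a presentation of [X] also presents some module equivalent to [Y], and
    that module is isomorphic to [X]. *)
Lemma phase_class_eq X Y : P X X -> P Y Y ->
  phase_class X = phase_class Y <-> req P X Y.
Proof.
move=> PX PY; split=> [e|[XY YX]].
  have [c Xc] := presentation_exists X.
  have : phase_class X c by exists X.
  rewrite e => -[Z [YZ ZY] Zc].
  have [_ iZX] := so_req_iso oP (presents_iso Xc Zc) PX.
  have [iXZ _] := so_req_iso oP (presents_iso Xc Zc) PX.
  by split; [apply: so_trans iXZ ZY|apply: so_trans YZ iZX].
apply: funext => c; apply: propext; split=> -[Z [h1 h2] Zc]; exists Z => //; split.
- exact: (so_trans oP YX).
- exact: (so_trans oP h2).
- exact: (so_trans oP XY).
- exact: (so_trans oP h2).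
Qed.

Definition class_le (p q : class_phase) : bool :=
  `[< exists X Y, [/\ sval p = phase_class X, sval q = phase_class Y & P X Y] >].

Lemma class_leE (p q : class_phase) X Y : P X X -> P Y Y ->
  sval p = phase_class X -> sval q = phase_class Y -> class_le p q <-> P X Y.
Proof.
move=> PX PY pX qY; split=> [/asboolP[X' [Y' [pX' qY' XY']]]|XY]; last first.
  by apply/asboolP; exists X, Y.
have [PX' PY'] := so_refl oP XY'.
have [XX' _] : req P X X' by apply/phase_class_eq => //; rewrite -pX.
have [_ Y'Y] : req P Y Y' by apply/phase_class_eq => //; rewrite -qY.
exact: (so_trans oP XX' (so_trans oP XY' Y'Y)).
Qed.

Lemma class_phaseP (p : class_phase) : exists2 X, P X X & sval p = phase_class X.
Proof. by case: p. Qed.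

Lemma class_le_anti : antisymmetric class_le.
Proof.
move=> p q /andP[pq qp].
have [X PX pX] := class_phaseP p; have [Y PY qY] := class_phaseP q.
suff e : sval p = sval q.
  by case: p q e {pq qp pX qY} => p hp [q hq]; apply: eq_exist.
rewrite pX qY; apply/phase_class_eq => //; split.
  by apply/(class_leE PX PY pX qY).
by apply/(class_leE PY PX qY pX).
Qed.

Lemma class_le_trans : transitive class_le.
Proof.
move=> q p r pq qr.
have [X PX pX] := class_phaseP p; have [Y PY qY] := class_phaseP q.
have [Z PZ rZ] := class_phaseP r.
apply/(class_leE PX PZ pX rZ); apply: (so_trans oP (Y := Y)).
  by apply/(class_leE PX PY pX qY).
by apply/(class_leE PY PZ qY rZ).
Qed.

Lemma class_le_total : total class_le.
Proof.
move=> p q; have [X PX pX] := class_phaseP p; have [Y PY qY] := class_phaseP q.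
by apply/orP; have [XY|YX] := so_total oP PX PY; [left|right];
  [apply/(class_leE PX PY pX qY)|apply/(class_leE PY PX qY pX)].
Qed.

HB.instance Definition _ := gen_eqMixin class_phase.
HB.instance Definition _ := gen_choiceMixin class_phase.
HB.instance Definition _ := Order.isOrder.Build (Order.Disp tt tt) class_phase
  (fun _ _ => erefl) (fun _ _ => erefl) (fun _ _ => erefl)
  class_le_anti class_le_trans class_le_total.

Definition class_of X (PX : P X X) : class_phase :=
  exist _ (phase_class X) (ex_intro2 _ _ X PX erefl).

Lemma class_of_le X Y (PX : P X X) (PY : P Y Y) :
  (class_of PX <= class_of PY)%O <-> P X Y.
Proof. exact: class_leE. Qed.

Lemma class_of_lt X Y (PX : P X X) (PY : P Y Y) :
  (class_of PX < class_of PY)%O <-> rlt P X Y.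
Proof.
rewrite ltNge; split=> [/negP n|[_ n]].
  by apply: so_rltN => // YX; apply/n/class_of_le.
by apply/negP => /class_of_le.
Qed.

Lemma class_of_surj (p : class_phase) : exists X (PX : P X X), p = class_of PX.
Proof. by case: p => p h; case: (h) => X PX e; exists X, PX; apply: eq_exist. Qed.

Definition class_slice (p : class_phase) X : Prop :=
  mod_zero X \/ exists PX : P X X, p = class_of PX.

Lemma class_slice_of X Y (PX : P X X) :
  class_slice (class_of PX) Y -> mod_zero Y \/ req P X Y.
Proof.
case=> [|[PY e]]; first by left.
by right; split; [apply/(class_of_le PX PY)|apply/(class_of_le PY PX)]; rewrite e.
Qed.

Lemma req_class_slice X Y (PX : P X X) : req P X Y -> class_slice (class_of PX) Y.
Proof.
move=> r; have [XY YX] := r; have [_ PY] := so_refl oP XY; right; exists PY.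
by apply: eq_exist; apply/phase_class_eq.
Qed.

Lemma class_slice_iso (p : class_phase) : iso_closed (class_slice p).
Proof.
have [X [PX ->]] := class_of_surj p.
move=> Y Z i /class_slice_of[Y0|[XY YX]]; first by left; apply: mod_zero_iso i Y0.
have [_ PY] := so_refl oP XY; have [YZ ZY] := so_req_iso oP i PY.
by apply: req_class_slice; split; [apply: so_trans XY YZ|apply: so_trans ZY YX].
Qed.

Lemma class_slice_neq0 (p : class_phase) : exists2 X, class_slice p X & ~ mod_zero X.
Proof.
have [X [PX ->]] := class_of_surj p.
by exists X; [apply: req_class_slice|apply: so_neq0 PX].
Qed.

(** [so_ext] only says that the middle term is semistable; its phase is squeezed between those of
    the submodule and of the quotient by [so_hom]. *)
Lemma class_slice_ext (p : class_phase) : extension_closed (class_slice p).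
Proof.
split=> [|X Y Z e pX pZ]; first by left.
have [X0|nX] := pselect (mod_zero X).
  exact: class_slice_iso (mod_iso_sym (ses_zero_sub X0 e)) pZ.
have [Z0|nZ] := pselect (mod_zero Z).
  exact: class_slice_iso (ses_zero_quot Z0 e) pX.
case: pX pZ => [//|[PX ->]] /class_slice_of[//|r].
have PY := so_ext oP e r; have [f [g [injf sg _]]] := e.
apply: req_class_slice; split.
  exact: (so_hom oP PX PY (inj_hom_neq0 injf nX)).
have [XZ ZX] := r; have [_ PZ] := so_refl oP XZ.
by apply: so_trans ZX; last exact: (so_hom oP PY PZ (surj_hom_neq0 sg nZ)).
Qed.

Lemma class_slice_hom (a b : class_phase) : (b < a)%O ->
  forall X Y, class_slice a X -> class_slice b Y -> hom_zero X Y.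
Proof.
move=> lt X Y [X0|[PX ea]]; first by move=> _ f x; rewrite (X0 x) raddf0.
case=> [Y0 f x|[PY eb]]; first exact: Y0.
apply: contrapT => /(so_hom oP PX PY) XY.
by move: lt; rewrite ea eb => /class_of_lt[].
Qed.

(** Terms and phases are indexed by [nat] so that the induction can append at the top, with [p0] as
    a default phase for the empty list. The last clause bounds all phases below by that of a new top
    factor. *)
Lemma filt_HN (p0 : class_phase) s X : ascending P s -> filt s X ->
  exists (n : nat) (F : nat -> fgmod R) (phi : nat -> class_phase),
  [/\ mod_zero (F 0%N), mod_iso (F n) X,
      forall i, (i < n)%N -> exists Y,
        [/\ short_exact (F i) (F i.+1) Y, ~ mod_zero Y & class_slice (phi i) Y],
      forall i j, (i < j < n)%N -> (phi j < phi i)%O &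
      forall Z (PZ : P Z Z), List.Forall (rlt P Z) s ->
        forall i, (i < n)%N -> (class_of PZ < phi i)%O].
Proof.
elim: s X => [|B s IH] X.
  move=> _ X0; exists 0%N, (fun=> X), (fun=> p0); split=> // [|i j].
    exact: mod_iso_refl.
  by rewrite ltn0 andbF.
move=> [PB Bs /IH{}IH] [X' e /IH[n [F [phi [F0 FX Fs dphi hphi]]]]].
exists n.+1, (fun i => if (i <= n)%N then F i else X),
  (fun i => if (i < n)%N then phi i else class_of PB); split=> //.
- by rewrite ltnn; apply: mod_iso_refl.
- move=> i lei; have /orP[/eqP ->|ltin] : (i == n) || (i < n)%N; first
    by rewrite -leq_eqVlt -ltnS.
    rewrite leqnn !ltnn; exists B; split; last exact: req_class_slice.
      (* The term [F n] is only isomorphic to [X'], so the sequence is transported along that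
         isomorphism. *)
      exact: ses_iso_sub FX e.
    exact: so_neq0 PB.
  by rewrite (ltnW ltin) ltin; apply: Fs.
- move=> i j /andP[ij lej].
  have /orP[/eqP ej|ltjn] : (j == n) || (j < n)%N; first
    by rewrite -leq_eqVlt -ltnS.
    by rewrite -ej ltnn ij; apply: hphi; rewrite // -ej.
  by rewrite ltjn (ltn_trans ij ltjn); apply: dphi; rewrite ij.
move=> Z PZ /List.Forall_cons_iff[ZB Zs] i _.
by case: ifP => [ltin|_]; [apply: hphi|apply/class_of_lt].
Qed.

Lemma class_slice_HN X : ~ mod_zero X -> has_HN_filtration class_slice X.
Proof.
move=> nX; have [[|B s] ascs fs] := so_HN oP nX; first by case: nX.
have [PB _ _] := ascs.
have [n [F [phi [F0 FX Fs dphi _]]]] := filt_HN (class_of PB) ascs fs.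
exists n, (fun i => F i), (fun i => phi i); split=> // [i|i j ij].
  exact: Fs (ltn_ord i).
by apply: dphi; rewrite ij ltn_ord.
Qed.

Definition realization : stability_data R :=
  StabilityData class_slice_iso class_slice_neq0 class_slice_ext class_slice_hom
    class_slice_HN.

Lemma phase_le_realization X Y : phase_le realization X Y <-> P X Y.
Proof.
split=> [[nX nY [a [b [le [//|[PX ea]] [//|[PY eb]]]]]]|XY].
  by move: le; rewrite ea eb => /class_of_le.
have [PX PY] := so_refl oP XY.
split; [exact: so_neq0 PX|exact: so_neq0 PY|].
exists (class_of PX), (class_of PY); split; [|exact: req_class_slice..].
exact/class_of_le.
Qed.
End Realization.

(** * Minimal preorders *)

Section Finest.
Variable R : pzRingType.
Implicit Types (X Y : fgmod R) (P Q : fgmod R -> fgmod R -> Prop).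
Implicit Types S T : stability_data R.

Definition encode P (c d : presentation R) : Prop :=
  exists X Y, [/\ presents X c, presents Y d & P X Y].

(** Nothing is lost by encoding: modules with a common presentation are isomorphic, hence
    [Q]-equivalent as soon as one is semistable. *)
Lemma encode_suborder P Q : semistable_order Q ->
  (forall c d, encode P c d -> encode Q c d) <-> suborder P Q.
Proof.
move=> oQ; split=> [PQ X Y XY|PQ c d [X [Y [Xc Yd /PQ]]]]; last by exists X, Y.
have [c Xc] := presentation_exists X; have [d Yd] := presentation_exists Y.
have [|X' [Y' [X'c Y'd XY']]] := PQ c d; first by exists X, Y.
have [QX' QY'] := so_refl oQ XY'.
have [_ XX'] := so_req_iso oQ (presents_iso X'c Xc) QX'.
have [Y'Y _] := so_req_iso oQ (presents_iso Y'd Yd) QY'.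
exact: (so_trans oQ XX' (so_trans oQ XY' Y'Y)).
Qed.

(* Zorn's lemma is applied to encodings, which live in a small universe. *)
Lemma minimal_order P0 : bounded_length R -> semistable_order P0 ->
  exists P, [/\ semistable_order P, suborder P P0 &
    forall Q, semistable_order Q -> suborder Q P -> suborder P Q].
Proof.
move=> bl oP0.
pose Code := {E : presentation R -> presentation R -> Prop |
  exists P, [/\ semistable_order P, suborder P P0 & E = encode P]}.
have codeP P (oP : semistable_order P) (PP0 : suborder P P0) :
  exists P, [/\ semistable_order P, suborder P P0 & encode P = encode P].
  by exists P.
pose code P oP PP0 : Code := exist _ (encode P) (ex_intro _ P (And3 oP PP0 erefl)).
(* The order is reversed inclusion, so the maximal element given by Zorn's lemma is a minimal
   preorder. *)
pose finer (E E' : Code) : bool := `[< forall c d, sval E' c d -> sval E c d >].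
have P00 : suborder P0 P0 by [].
have [|||E minE] := @ZL_preorder Code (code P0 oP0 P00) finer.
- by move=> E; apply/asboolP.
- by move=> E2 E1 E3 /asboolP h1 /asboolP h2; apply/asboolP => c d /h2/h1.
- move=> A totA.
  pose CC P := exists2 E, A E &
    [/\ semistable_order P, suborder P P0 & sval E = encode P].
  have [[P1 CP1]|nC] := pselect (exists P, CC P); last first.
    (* The empty chain is bounded by the initial preorder. *)
    exists (code P0 oP0 P00) => E AE; case: nC.
    by have [P hP] := svalP E; exists P, E.
  have oI : semistable_order (fun X Y => forall P, CC P -> P X Y).
    apply: chain_inter => //; [by exists P1|by move=> P [E _ []]|].
    move=> P Q [E AE [oP _ eP]] [F AF [oQ _ eQ]].
    have [/asboolP|/asboolP] := totA _ _ AE AF; rewrite eP eQ => h.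
      by right; apply/encode_suborder.
    by left; apply/encode_suborder.
  have IP0 : suborder (fun X Y => forall P, CC P -> P X Y) P0.
    by move=> X Y h; have [E AE [_ P1P0 _]] := CP1; apply: P1P0; apply: h.
  exists (code _ oI IP0) => E AE; have [P [oP PP0 eP]] := svalP E.
  apply/asboolP; rewrite eP; apply/encode_suborder => // X Y; apply.
  by exists E.
have [P [oP PP0 eP]] := svalP E; exists P; split=> // Q oQ QP.
have QP0 : suborder Q P0 by move=> X Y /QP/PP0.
have : finer E (code Q oQ QP0).
  by apply/asboolP; rewrite eP; apply/encode_suborder.
by move=> /minE/asboolP; rewrite eP => /encode_suborder; apply.
Qed.

(** A stability data finer than the realization of a minimal [P] has its preorder inside [P], hence
    equal to [P], and is therefore equivalent to the realization. *)
Lemma refine_finest S : bounded_length R ->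
  exists T : stability_data R, sd_finer T S /\ sd_finest T.
Proof.
move=> bl; have [P [oP PS minP]] := minimal_order bl (phase_le_order S).
exists (realization oP); split.
  by apply: phase_le_finer => X Y /phase_le_realization/PS.
move=> T TP; apply: (finer_equivalent TP) => X Y /phase_le_realization.
apply: minP; first exact: phase_le_order.
by move=> X' Y' /(finer_phase_le TP)/phase_le_realization.
Qed.
End Finest.

(** * Bounded length *)

Section FiniteDimensional.
Variables (k : fieldType) (R : pzRingType) (iota : k -> R).
Hypothesis iotaD : forall a b, iota (a + b) = iota a + iota b.
Hypothesis iotaM : forall a b, iota (a * b) = iota a * iota b.
Hypothesis iota1 : iota 1 = 1.
Implicit Types (V W : lmodType R) (X : fgmod R).

Lemma iota0 : iota 0 = 0.
Proof. by apply: (addrI (iota 0)); rewrite -iotaD !addr0. Qed.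

Lemma iota_sum (I : finType) (F : I -> k) : iota (\sum_i F i) = \sum_i iota (F i).
Proof. exact: (big_morph iota iotaD iota0). Qed.

(** The field acts on every module through [iota], and this is its linear algebra. *)
Definition spanning V (I : finType) (e : I -> V) : Prop :=
  forall x, exists c : I -> k, x = \sum_i iota (c i) *: e i.

Definition independent V n (v : 'I_n -> V) : Prop :=
  forall c : 'I_n -> k, \sum_i iota (c i) *: v i = 0 -> forall i, c i = 0.

(** A row vector killed by the matrix of coordinates is a linear relation between the [v i], so that
    matrix has rank [n]. *)
Lemma independent_le V (I : finType) (e : I -> V) n (v : 'I_n -> V) :
  spanning e -> independent v -> (n <= #|I|)%N.
Proof.
move=> se iv; pose co i := projT1 (cid (se (v i))).
have coP i : v i = \sum_j iota (co i j) *: e j by rewrite /co; case: cid.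
pose C : 'M[k]_(n, #|I|) := \matrix_(i, j) co i (enum_val j).
suff : row_free C by move=> /eqP <-; apply: rank_leq_col.
rewrite -kermx_eq0; apply: contraT => /rowV0Pn[u /sub_kermxP uC /eqP[]].
apply/rowP => i; rewrite mxE; apply: (iv (fun i => u 0 i)).
transitivity (\sum_j iota (\sum_i u 0 i * co i j) *: e j).
  under eq_bigr => i' _ do rewrite coP scaler_sumr.
  rewrite exchange_big; apply: eq_bigr => j _ /=.
  rewrite iota_sum scaler_suml; apply: eq_bigr => i' _.
  by rewrite iotaM scalerA.
apply: big1 => j _; rewrite (_ : \sum_i _ = 0) ?iota0 ?scale0r //.
have := congr1 (fun M : 'rV[k]_#|I| => M 0 (enum_rank j)) uC.
rewrite [LHS]mxE [RHS]mxE => h; rewrite -[RHS]h; apply: eq_bigr => i' _.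
by rewrite mxE enum_rankK.
Qed.

(** Each factor contributes one vector, a lift of a non-zero element. Projecting a relation to the
    top factor kills the other terms, and a non-zero coefficient would be invertible. *)
Lemma filt_independent s X :
  List.Forall (fun B : fgmod R => ~ mod_zero B) s -> filt s X ->
  exists v : 'I_(size s) -> X, independent v.
Proof.
elim: s X => [|B s IH] X; first by move=> _ _; exists (fun=> 0) => c _ [].
move=> /List.Forall_cons_iff[nB /IH{}IH] [X' [f [g [injf sg ex]]] /IH[v iv]].
have /existsNP[b nb] := nB; have [x gx] := sg b.
exists (fun i => if unlift ord0 i is Some j then f (v j) else x) => c.
rewrite big_ord_recl unlift_none.
under eq_bigr => j _ do rewrite liftK -linearZ.
rewrite -linear_sum /= => e0.
have c0 : c ord0 = 0.
  apply: contrapT => /eqP nc; apply: nb; rewrite -gx.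
  have : g (iota (c ord0) *: x) = 0.
    have := congr1 g e0; rewrite linearD raddf0.
    rewrite [X in _ + X](_ : _ = 0) ?addr0 //.
    by apply/ex; eexists.
  rewrite linearZ /= => /(congr1 (fun y => iota (c ord0)^-1 *: y)).
  by rewrite scaler0 scalerA -iotaM mulVf // iota1 scale1r.
move: e0; rewrite c0 iota0 scale0r add0r -(raddf0 f) => /injf/iv cj i.
by case: (unliftP ord0 i) => [j ->|->].
Qed.

Lemma finite_bounded_length (I : finType) (e : I -> R) :
  (forall x, exists c : I -> k, x = \sum_i iota (c i) * e i) -> bounded_length R.
Proof.
move=> se X; have [n [u uP]] := fgmodP X.
have sX : spanning (fun ij : 'I_n * I => e ij.2 *: u ij.1).
  move=> x; have [a ->] := uP x.
  have [c cP] : exists c : 'I_n -> I -> k, forall i, a i = \sum_j iota (c i j) * e j.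
    by exists (fun i => projT1 (cid (se (a i)))) => i; case: cid.
  exists (fun ij => c ij.1 ij.2).
  rewrite -(pair_bigA _ (fun i j => iota (c i j) *: (e j *: u i))) /=.
  apply: eq_bigr => i _; rewrite cP scaler_suml.
  by apply: eq_bigr => j _; rewrite scalerA.
exists #|{: 'I_n * I}| => s ns fs.
by have [v iv] := filt_independent ns fs; apply: independent_le sX iv.
Qed.
End FiniteDimensional.

(** * Finite dimension of the path algebra of an acyclic quiver *)

Section PathAlgebra.
Variable Q : quiver.

(** If the starting vertex recurs, the walk cut at a recurrence is a cycle; otherwise the repetition
    survives removal of the first arrow. *)
Lemma walk_cycle (x : vertex Q) s :
  walk x s -> ~~ uniq (x :: [seq tgt a | a <- s]) ->
  exists p : qpath Q, (0 < plen p)%N /\ psrc p = ptgt p.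
Proof.
elim: s x => [|a s IH] x //= /andP[/eqP sa ws]; rewrite -/(map _ (a :: s)).
rewrite -[X in ~~ X]/((x \notin [seq tgt b | b <- a :: s]) &&
  uniq (tgt a :: [seq tgt b | b <- s])).
rewrite negb_and negbK => /orP[|]; last exact: IH.
have wx : walk x (a :: s) by rewrite /= sa eqxx.
move: {sa ws IH} (a :: s) wx => {}s wx /mapP[b bs xb].
case/splitPr: bs wx => s1 s2; rewrite -cat_rcons walk_cat => /andP[w1 _].
exists (@QPath Q (x, rcons s1 b) w1); split; first by rewrite /plen /= size_rcons.
by rewrite /ptgt /= map_rcons last_rcons.
Qed.

Lemma acyclic_plen (p : qpath Q) : qacyclic Q -> (plen p <= #|vertex Q|)%N.
Proof.
move=> ac; have [u|nu] := boolP (uniq (psrc p :: [seq tgt a | a <- p.2])).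
  have := max_card (mem (psrc p :: [seq tgt a | a <- p.2])).
  by rewrite (card_uniqP u) /= size_map; apply: ltnW.
have [q [q0 /eqP e]] := walk_cycle (qpvalP p) nu.
by have := ac q q0; rewrite e.
Qed.

Variable k : fieldType.

Lemma pscaleM (a b : k) (o : option (qpath Q)) :
  pscale (a * b) o = a *: pscale b o :> pathalg k Q.
Proof.
case: o => [p|] /=; last by rewrite scaler0.
apply/malgP => q.
by rewrite mcoeffZ [X in _ = _ * X]mcoeffU [LHS]mcoeffU mulrnAr.
Qed.

Lemma pa_mulZr c (f g : pathalg k Q) : f * (c *: g) = c *: (f * g).
Proof.
rewrite -[LHS]/(pa_mul f (c *: g)) -[f * g]/(pa_mul f g).
rewrite (pa_mulw (fsubset_refl (msupp f)) (msuppZ_le c g)) pa_mul.unlock.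
rewrite scaler_sumr; apply: eq_bigr => p _.
rewrite scaler_sumr; apply: eq_bigr => q _.
by rewrite mcoeffZ mulrCA; apply: pscaleM.
Qed.

Lemma pathalg_bounded_length : qacyclic Q -> bounded_length (pathalg k Q)^c.
Proof.
move=> ac.
(* Paths have length at most the number of vertices, so they are indexed by bounded sequences of
   arrows; indices that are not paths give [0]. *)
pose I : finType := (vertex Q * (#|vertex Q|).-bseq (arrow Q))%type.
pose e (i : I) : pathalg k Q :=
  if insub (i.1, i.2 : seq _) is Some p then << 1 *g (p : qpath Q) >> else 0.
pose iota (c : k) : pathalg k Q := c *: (1 : pathalg k Q).
apply: (@finite_bounded_length k (pathalg k Q)^c iota _ _ _ I e).
- by move=> a b; apply: scalerDl.
(* The product of the converse ring is unfolded, which swaps the two factors. *)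
- move=> a b; rewrite -[RHS]/(iota b * (a *: (1 : pathalg k Q))).
  by rewrite pa_mulZr mulr1 scalerA.
- exact: scale1r.
have eE (c : I -> k) : \sum_i ((iota (c i) : (pathalg k Q)^c) * e i) =
    \sum_i c i *: e i :> pathalg k Q.
  by apply: eq_bigr => i _; rewrite -[LHS]/(e i * iota (c i)) pa_mulZr mulr1.
move=> x; suff [c cP] : exists c : I -> k, x = \sum_i c i *: e i.
  by exists c; rewrite eE.
elim/pathalg_ind: x => [|x y [c ->] [d ->]|c p].
- by exists (fun=> 0); rewrite big1 // => i _; rewrite scale0r.
- exists (fun i => c i + d i); rewrite -big_split /=.
  by apply: eq_bigr => i _; rewrite scalerDl.
pose i0 : I := (p.1, Bseq (acyclic_plen p ac)).
exists (fun i => if i == i0 then c else 0).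
rewrite (bigD1 i0) //= eqxx big1 => [|i /negbTE->]; last by rewrite scale0r.
rewrite addr0 /e /= -surjective_pairing valK.
by rewrite -[RHS](pscaleM c 1 (Some p)) mulr1.
Qed.
End PathAlgebra.

Theorem proposition5p1 (k : closedFieldType) (Q : quiver) (hQ : tame Q)
    (S : stability_data (pathalg k Q)^c) :
  exists T : stability_data (pathalg k Q)^c, sd_finer T S /\ sd_finest T.
Proof.
by apply: refine_finest; have [_ ac _] := hQ; apply: pathalg_bounded_length.
Qed.
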